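(* Let $E_{\frac13}$ be the elliptic curve defined by $$E_{\frac13}: y^2 = (x-1)\left(x^2+\tfrac13\right).$$ Then for $p$ a prime with $p>3$, $$-\frac{\phi_p(-2)}{p}\cdot a_p\left(E_{\frac13}\right) = 2\,\mathrm{Re}\binom{\chi_3}{\phi_p}$$ and $$-\phi_p(2)\cdot a_p\left(E_{\frac13}\right) = 2\,\mathrm{Re}\left[\frac{G(\chi_3)\,G(\phi_p)}{G(\chi_3\,\phi_p)}\right],$$ where $a_p(E_{\frac13})$ is the trace of Frobenius of $E_{\frac13}$, $\phi_p$ is the quadratic character mod $p$, $\chi_3$ is a character of order three of $\mathbb{F}_p$, $\binom{\cdot}{\cdot}$ is the finite field binomial coefficient of characters, and $G(\chi)$ is a Gauss sum.
   Context: $\mathbb{F}_p$ is the finite field with $p$ elements. Characters are complex-valued multiplicative characters $\chi$ of $\mathbb{F}_p^*$, with domain extended to $\mathbb{F}_p$ by $\chi(0):=0$. Products of characters are pointwise, and $\overline{B}$ is the complex conjugate (inverse) character of $B$. Jacobi sum: $J(\chi,\lambda)=\sum_{x\in\mathbb{F}_p}\chi(x)\lambda(1-x)$. Gauss sum: $G(\chi)=\sum_{x\in\mathbb{F}_p}\chi(x)\,e^{2\pi i x/p}$. Finite field binomial coefficient: for characters $A,B$ of $\mathbb{F}_p$, $$\binom{A}{B} := \frac{B(-1)}{p}\,J(A,\overline{B}).$$ Trace of Frobenius: for an elliptic curve $E/\mathbb{Q}$ and a prime $p$ of good reduction, $a_p(E) := 1+p-N_p$, where $N_p$ is the number of $\mathbb{F}_p$-rational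 points (including the point at infinity) on the reduction of $E$ modulo $p$. *)

(* Defs.v *)
From HB Require Import structures.
From mathcomp Require Import all_boot all_order all_algebra.
From mathcomp Require Import fingroup cyclic.
From mathcomp Require Import reals trigo.
From mathcomp Require Import complex.
From mathcomp Require Import ring.

Set Implicit Arguments.
Unset Strict Implicit.
Unset Printing Implicit Defensive.

Import Order.TTheory GRing.Theory Num.Theory.
Local Open Scope ring_scope.

(* Weierstrass equations
     y^2 + a1 x y + a3 y = x^3 + a2 x^2 + a4 x + a6. *)
Record weierstrass (F : Type) := Weierstrass {
  wa1 : F; wa2 : F; wa3 : F; wa4 : F; wa6 : F }.

Definition on_affine_curve (F : nzRingType) (W : weierstrass F) (x y : F) : bool :=
  y ^+ 2 + wa1 W * x * y + wa3 W * y
    == x ^+ 3 + wa2 W * x ^+ 2 + wa4 W * x + wa6 W.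

(* [None] is the point at infinity. *)
Definition on_curve (F : nzRingType) (W : weierstrass F)
    (P : option (F * F)) : bool :=
  if P is Some (x, y) then on_affine_curve W x y else true.

Definition wdisc (F : nzRingType) (W : weierstrass F) : F :=
  let b2 := wa1 W ^+ 2 + 4 * wa2 W in
  let b4 := 2 * wa4 W + wa1 W * wa3 W in
  let b6 := wa3 W ^+ 2 + 4 * wa6 W in
  let b8 := wa1 W ^+ 2 * wa6 W + 4 * wa2 W * wa6 W - wa1 W * wa3 W * wa4 W
            + wa2 W * wa3 W ^+ 2 - wa4 W ^+ 2 in
  - (b2 ^+ 2 * b8) - 8 * b4 ^+ 3 - 27 * b6 ^+ 2 + 9 * b2 * b4 * b6.

Record elliptic_curve (F : nzRingType) := EllipticCurve {
  ec_model :> weierstrass F;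
  ec_nonsingular : wdisc ec_model != 0 }.

(* Coefficientwise reduction; [ratr a] is the numerator of [a] over its
   denominator, so it is the residue of [a] when [a] is p-integral. *)
Definition reduction (p : nat) (W : weierstrass rat) : weierstrass 'F_p :=
  Weierstrass (ratr (wa1 W)) (ratr (wa2 W)) (ratr (wa3 W))
              (ratr (wa4 W)) (ratr (wa6 W)).

Definition p_integral (p : nat) (a : rat) : bool := ~~ (p %| `|denq a|)%N.

(* The model is p-integral and its reduction is nonsingular; such a model is
   minimal at p, so its reduction is the reduction of the curve. *)
Definition good_reduction (p : nat) (W : weierstrass rat) : bool :=
  all (p_integral p) [:: wa1 W; wa2 W; wa3 W; wa4 W; wa6 W]
  && (wdisc (reduction p W) != 0).

(* Meaningful for p prime with [good_reduction p E]. *)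
Definition trace_of_frobenius (p : nat) (E : elliptic_curve rat) : int :=
  1 + p%:Z - (#|[set P : option ('F_p * 'F_p) | on_curve (reduction p E) P]|)%:Z.

Definition E_third_model : weierstrass rat :=
  Weierstrass 0 (-1) 0 (1 / 3) (- (1 / 3)).

Fact E_third_nonsingular : wdisc E_third_model != 0.
Proof. by []. Qed.

Definition E_third : elliptic_curve rat := EllipticCurve E_third_nonsingular.

Lemma on_E_third (x y : rat) :
  on_affine_curve E_third x y = (y ^+ 2 == (x - 1) * (x ^+ 2 + 1 / 3)).
Proof.
rewrite /on_affine_curve /=; congr (_ == _); first by ring.
by field.
Qed.

Fact E_third_disc_field (F : fieldType) : (3 : F) != 0 ->
  wdisc (Weierstrass 0 (-1) 0 (1 / 3) (- 3^-1)) = - (2 ^+ 10) / 3 ^+ 3 :> F.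
Proof. by move=> n3; rewrite /wdisc /=; field; rewrite n3 (natrX _ 3 3) expf_neq0. Qed.

Lemma E_third_good_reduction (p : nat) :
  prime p -> (3 < p)%N -> good_reduction p E_third.
Proof.
move=> p_pr p_gt3.
have ndvd n : (0 < n <= 3)%N -> ~~ (p %| n)%N.
  by case/andP=> n0 n3; rewrite gtnNdvd // (leq_ltn_trans n3).
have p2 := ndvd 2%N isT; have p3 := ndvd 3%N isT; have p1 := ndvd 1%N isT.
have n2 : (2 : 'F_p) != 0 by rewrite -(dvdn_pcharf (pchar_Fp p_pr) 2).
have n3 : (3 : 'F_p) != 0 by rewrite -(dvdn_pcharf (pchar_Fp p_pr) 3).
apply/andP; split.
  by rewrite /= /p_integral; apply/and5P; split; rewrite ?andbT.
have ratrE (a : rat) (n d : int) : numq a = n -> denq a = d ->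
    ratr a = n%:~R / d%:~R :> 'F_p by rewrite /ratr => -> ->.
have -> : reduction p E_third = Weierstrass 0 (-1) 0 (1 / 3) (- 3^-1).
  rewrite /reduction (ratrE (wa1 E_third) 0 1) // (ratrE (wa2 E_third) (-1) 1) //.
  rewrite (ratrE (wa4 E_third) 1 3) //.
  by rewrite (ratrE (wa6 E_third) (-1) 3) // mulr0z rmorphN1 !divr1 mulN1r.
by rewrite E_third_disc_field // mulf_neq0 ?oppr_eq0 ?invr_eq0 ?expf_neq0.
Qed.

(* A character of F_p^*, extended by 0 at 0. *)
Record mulchar (R : realType) (p : nat) := MulChar {
  mulchar_fun :> 'F_p -> R[i];
  mulchar0 : mulchar_fun 0 = 0;
  mulchar1 : mulchar_fun 1 = 1;
  mulcharM : {morph mulchar_fun : x y / x * y} }.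

Section MulCharOperations.
Variables (R : realType) (p : nat).
Implicit Types chi psi : mulchar R p.

Fact mulchar_mul0 chi psi : chi 0 * psi 0 = 0.
Proof. by rewrite mulchar0 mul0r. Qed.

Fact mulchar_mul1 chi psi : chi 1 * psi 1 = 1.
Proof. by rewrite !mulchar1 mulr1. Qed.

Fact mulchar_mulM chi psi : {morph (fun x => chi x * psi x) : x y / x * y}.
Proof. by move=> x y; rewrite !mulcharM mulrACA. Qed.

Definition mulchar_mul chi psi : mulchar R p :=
  @MulChar R p (fun x => chi x * psi x)
    (mulchar_mul0 chi psi) (mulchar_mul1 chi psi) (mulchar_mulM chi psi).

Fact mulchar_conj0 chi : (chi 0)^* = 0.
Proof. by rewrite mulchar0 rmorph0. Qed.

Fact mulchar_conj1 chi : (chi 1)^* = 1.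
Proof. by rewrite mulchar1 rmorph1. Qed.

Fact mulchar_conjM chi : {morph (fun x => (chi x)^* ) : x y / x * y}.
Proof. by move=> x y; rewrite mulcharM rmorphM. Qed.

Definition mulchar_conj chi : mulchar R p :=
  @MulChar R p (fun x => (chi x)^* )
    (mulchar_conj0 chi) (mulchar_conj1 chi) (mulchar_conjM chi).

(* n is the order of chi in the group of characters of F_p^*. *)
Definition mulchar_has_order chi (n : nat) : Prop :=
  [/\ (0 < n)%N,
      forall x : 'F_p, x != 0 -> chi x ^+ n = 1
    & forall m : nat, (0 < m < n)%N ->
        exists2 x : 'F_p, x != 0 & chi x ^+ m != 1].

Definition legendre (x : 'F_p) : R[i] :=
  if x == 0 then 0 else if [exists y : 'F_p, y ^+ 2 == x] then 1 else -1.

Fact legendre0 : legendre 0 = 0.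
Proof. by rewrite /legendre eqxx. Qed.

Fact legendre1 : legendre 1 = 1.
Proof.
rewrite /legendre oner_eq0; case: existsP => // -[].
by exists 1; rewrite expr1n.
Qed.

Fact legendreM : {morph legendre : x y / x * y}.
Proof.
move=> x y; rewrite /legendre mulf_eq0.
case: (boolP (x == 0)) => [_|x0] /=; first by rewrite mul0r.
case: (boolP (y == 0)) => [_|y0] /=; first by rewrite mulr0.
have [|nx] := boolP [exists z, z ^+ 2 == x].
  case/existsP=> u /eqP xE; rewrite mul1r.
  have u0 : u != 0 by apply: contraNneq x0 => u0; rewrite -xE u0 expr0n.
  congr (if _ then _ else _); apply/existsP/existsP => -[v /eqP vE].
    by exists (v / u); rewrite expr_div_n vE -xE mulrAC mulfV ?mul1r ?expf_neq0.
  by exists (u * v); rewrite exprMn xE vE.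
have [|ny] := boolP [exists z, z ^+ 2 == y].
  case/existsP=> u /eqP yE; rewrite mulr1 ifF //.
  have u0 : u != 0 by apply: contraNneq y0 => u0; rewrite -yE u0 expr0n.
  apply: contraNF nx => /existsP[v /eqP vE].
  by apply/existsP; exists (v / u); rewrite expr_div_n vE -yE mulfK ?expf_neq0.
rewrite mulrNN mulr1 ifT //.
have /cyclicP[g gE] := field_unit_group_cyclic [set: {unit 'F_p}]%G.
have odd_log z : z != 0 -> ~~ [exists w, w ^+ 2 == z] ->
    exists2 i, odd i & z = val g ^+ i.
  move=> z0 nz; have zU : z \is a GRing.unit by rewrite unitfE.
  have : FinRing.unit _ zU \in <[g]>%g by rewrite -gE inE.
  case/cycleP=> i /(congr1 val); rewrite /= FinRing.val_unitX /= => zE; exists i => //.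
  apply: contraNT nz => ei; apply/existsP; exists (val g ^+ i./2).
  by rewrite zE -exprM muln2 halfK (negPf ei) subn0.
have [i oi ->] := odd_log x x0 nx; have [j oj ->] := odd_log y y0 ny.
apply/existsP; exists (val g ^+ (i + j)./2).
by rewrite -exprD -exprM muln2 halfK oddD oi oj subn0.
Qed.

Definition quadratic_char : mulchar R p := MulChar legendre0 legendre1 legendreM.

Definition jacobi_sum chi psi : R[i] := \sum_(x : 'F_p) chi x * psi (1 - x).

Definition expi (t : R) : R[i] := (cos t +i* sin t)%C.

(* The sum of chi(x) e^(2 pi i x / p), x being lifted to {0, ..., p - 1}. *)
Definition gauss_sum chi : R[i] :=
  \sum_(x : 'F_p) chi x * expi (2 * pi * (x : nat)%:R / p%:R).

Definition ff_binomial chi psi : R[i] :=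
  psi (-1) / p%:R * jacobi_sum chi (mulchar_conj psi).

End MulCharOperations.

(* Main.v *)
Require Import Defs.
From mathcomp Require Import all_boot all_order all_algebra.
From mathcomp Require Import reals complex.
From mathcomp Require Import cyclic finfield trigo ring.

Set Implicit Arguments.
Unset Strict Implicit.
Unset Printing Implicit Defensive.

Import Order.TTheory GRing.Theory Num.Theory.
Local Open Scope ring_scope.

(** The substitution x = 1 - (2/3) (1 - t) turns (x - 1) (x^2 + 1/3) into
    - (8/27) (1 - t^3), so the curve is the quadratic twist by -6 of
    y^2 = 1 - t^3.  A character of order 3 exists only if F_p contains a
    primitive cube root of unity w, and then -3 = (2 w + 1)^2 is a square; the
    twist is therefore by 2, and
      a_p = - sum_x phi((x - 1) (x^2 + 1/3)) = - phi(2) sum_t phi(1 - t^3)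
    ([trace_of_frobenius_E_third], [sum_E_third_cubic], [quadratic_char_N3]).

    The number of cube roots of x in F_p is 1 + chi3(x) + chi3(x)^2
    ([card_nth_roots_mulchar]), and chi3^2 is the complex conjugate of chi3.
    Grouping the last sum according to the value of t^3, the term 1 contributes
    sum_x phi(1 - x) = 0 and the other two contribute a Jacobi sum and its
    conjugate, so that
      sum_t phi(1 - t^3) = 2 Re J(chi3, phi)   ([sum_cubic_jacobi]).
    The binomial coefficient is phi(-1) J(chi3, phi) / p, which gives the first
    identity.  The second one follows from the first computation and
      G(chi3) G(phi) = J(chi3, phi) G(chi3 phi), with G(chi3 phi) nonzero,
    which hold because chi3 phi is a nontrivial character
    ([gauss_sum_mul], [gauss_sum_neq0]). *)

(** * Roots of unity in a finite field *)

Lemma finField_primitive_root (F : finFieldType) :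
  exists g : F, #|F|.-1.-primitive_root g.
Proof.
have F1 := finNzRing_gt1 F.
have F0 : (0 < #|F|.-1)%N by rewrite -subn1 subn_gt0.
have /hasP[g g_prim] : has #|F|.-1.-primitive_root (enum [set x : F | x != 0]).
  apply: has_prim_root => //.
  (* The nonzero elements are #|F| - 1 distinct roots of 'X^(#|F| - 1) - 1. *)
  - apply/allP=> x; rewrite mem_enum inE => x0.
    rewrite unity_rootE -(inj_eq (mulfI x0)) -exprS.
    by rewrite prednK ?expf_card ?mulr1 // ltnW.
  - exact: enum_uniq.
  - by rewrite -cardE cardsE (cardC1 0).
by exists g.
Qed.

Lemma finField_primitive_rootP (F : finFieldType) (g x : F) :
  #|F|.-1.-primitive_root g -> x != 0 -> exists i : nat, x = g ^+ i.
Proof.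
move=> g_prim x0; have F1 := finNzRing_gt1 F.
have [|i ->] := prim_rootP g_prim (x := x); last by exists i.
by apply: (mulfI x0); rewrite -exprS prednK ?expf_card ?mulr1 // ltnW.
Qed.

(** Two n-th roots of the same nonzero element differ by an n-th root of unity,
    that is, by a power of w. *)
Lemma card_nth_roots (F : finFieldType) (n : nat) (w t : F) :
  n.-primitive_root w -> t != 0 -> #|[set s | s ^+ n == t ^+ n]| = n.
Proof.
move=> w_prim t0.
have -> : [set s | s ^+ n == t ^+ n] = [set t * w ^+ i | i : 'I_n].
  apply/setP=> s; rewrite inE; apply/eqP/imsetP => [sn | [i _ ->]]; last first.
    by rewrite exprMn -exprM mulnC exprM (prim_expr_order w_prim) expr1n mulr1.
  have [|i sE] := prim_rootP w_prim (x := s / t).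
    by rewrite expr_div_n sn divff ?expf_neq0.
  by exists i => //; rewrite -sE mulrCA divff ?mulr1.
rewrite card_imset ?card_ord // => i j /(mulfI t0)/eqP.
by rewrite (eq_prim_root_expr w_prim) !modn_small // => /eqP/val_inj.
Qed.

(** * Multiplicative characters of order n *)

Lemma sum_exprs_eq0 (K : fieldType) (n : nat) (z : K) :
  z ^+ n = 1 -> z != 1 -> \sum_(k < n) z ^+ k = 0.
Proof.
move=> zn z1; have /eqP := subrX1 z n.
by rewrite zn subrr eq_sym mulf_eq0 subr_eq0 (negPf z1) => /eqP.
Qed.

Lemma mulcharX (R : realType) (p : nat) (chi : mulchar R p) (x : 'F_p) (n : nat) :
  chi (x ^+ n) = chi x ^+ n.
Proof.
by elim: n => [|n IHn]; rewrite ?expr0 ?mulchar1 // !exprS mulcharM IHn.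
Qed.

Lemma mulchar_neq0 (R : realType) (p : nat) (chi : mulchar R p) (x : 'F_p) :
  x != 0 -> chi x != 0.
Proof.
move=> x0; apply/eqP=> chix0; have /eqP := mulchar1 chi.
by rewrite -(mulfV x0) mulcharM chix0 mul0r eq_sym oner_eq0.
Qed.

(** Multiplying the variable by a permutes the terms and scales the sum by
    chi a. *)
Lemma sum_mulchar_eq0 (R : realType) (p : nat) (chi : mulchar R p) (a : 'F_p) :
  a != 0 -> chi a != 1 -> \sum_x chi x = 0.
Proof.
move=> a0 chia; apply/eqP.
have: chi a * \sum_x chi x = \sum_x chi x.
  rewrite mulr_sumr [RHS](reindex_inj (mulfI a0)) /=.
  by apply: eq_bigr => x _; rewrite mulcharM.
move/eqP; rewrite -subr_eq0 -{2}[\sum_x _]mul1r -mulrBl mulf_eq0 subr_eq0.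
by rewrite (negPf chia).
Qed.

(** The values of chi on nonzero elements are powers of chi g, so if
    chi g ^+ m = 1 then the m-th power of chi is trivial. *)
Lemma mulchar_order_primitive (R : realType) (p : nat) (chi : mulchar R p)
    (n : nat) (g : 'F_p) :
  #|'F_p|.-1.-primitive_root g -> mulchar_has_order chi n ->
  n.-primitive_root (chi g).
Proof.
move=> g_prim [n0 chin chim].
have g0 : g != 0 by rewrite (prim_root_eq0 g_prim) -lt0n (prim_order_gt0 g_prim).
have [m m_prim mn] := prim_order_exists n0 (chin g g0).
suff -> : n = m by [].
apply/eqP; rewrite eqn_leq (dvdn_leq n0 mn) andbT leqNgt.
apply/negP=> m_lt_n; have [|x x0 /eqP[]] := chim m.
  by rewrite m_lt_n (prim_order_gt0 m_prim).
have [i ->] := finField_primitive_rootP g_prim x0.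
by rewrite mulcharX -exprM mulnC exprM (prim_expr_order m_prim) expr1n.
Qed.

(** The order of a character divides p - 1, since chi g has order n and
    g ^+ (p - 1) = 1. *)
Lemma mulchar_order_nth_root (R : realType) (p : nat) (chi : mulchar R p) (n : nat) :
  mulchar_has_order chi n -> exists w : 'F_p, n.-primitive_root w.
Proof.
move=> chi_order; have [g g_prim] := finField_primitive_root 'F_p.
have chig := mulchar_order_primitive g_prim chi_order.
exists (g ^+ (#|'F_p|.-1 %/ n)); apply: (dvdn_prim_root g_prim).
by rewrite (prim_order_dvd chig) -mulcharX (prim_expr_order g_prim) mulchar1.
Qed.

(** With x = g ^+ i, both sides are n when n divides i.  Otherwise x has no n-th
    root, and chi x is a nontrivial n-th root of unity, so that the geometric
    sum vanishes.  At x = 0 only the term k = 0 survives, as 0 ^+ 0 = 1. *)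
Lemma card_nth_roots_mulchar (R : realType) (p : nat) (chi : mulchar R p)
    (n : nat) (x : 'F_p) :
  mulchar_has_order chi n ->
  #|[set t : 'F_p | t ^+ n == x]|%:R = \sum_(k < n) chi x ^+ k.
Proof.
move=> chi_order; have [n0 chin _] := chi_order.
have [->|x0] := eqVneq x 0.
  have -> : [set t : 'F_p | t ^+ n == 0] = [set 0].
    by apply/setP=> t; rewrite !inE expf_eq0 n0.
  rewrite cards1 mulchar0 -(prednK n0) big_ord_recl expr0 big1 ?addr0 // => i _.
  by rewrite expr0n.
have [w w_prim] := mulchar_order_nth_root chi_order.
have [g g_prim] := finField_primitive_root 'F_p.
have chig := mulchar_order_primitive g_prim chi_order.
have [i xE] := finField_primitive_rootP g_prim x0.
have [/dvdnP[j iE]|n_ndvd_i] := boolP (n %| i)%N.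
  have xE' : x = (g ^+ j) ^+ n by rewrite xE iE exprM.
  have gj0 : g ^+ j != 0.
    by apply: contraNneq x0 => gj0; rewrite xE' gj0 expr0n -(prednK n0).
  rewrite {1}xE' (card_nth_roots w_prim gj0) xE' mulcharX.
  rewrite (eq_bigr (fun=> 1)) ?sumr_const ?card_ord // => k _.
  by rewrite (chin _ gj0) expr1n.
have chix : chi x != 1 by rewrite xE mulcharX -(prim_order_dvd chig).
rewrite (sum_exprs_eq0 (chin x x0) chix).
suff -> : [set t : 'F_p | t ^+ n == x] = set0 by rewrite cards0.
apply/setP=> t; rewrite !inE; apply: contraNF chix => /eqP tn.
have t0 : t != 0 by apply: contraNneq x0 => t0; rewrite -tn t0 expr0n -(prednK n0).
by rewrite -tn mulcharX chin.
Qed.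

Lemma sum_comp_nth_power (R : realType) (p : nat) (chi : mulchar R p) (n : nat)
    (f : 'F_p -> R[i]) :
  mulchar_has_order chi n ->
  \sum_t f (t ^+ n) = \sum_x (\sum_(k < n) chi x ^+ k) * f x.
Proof.
move=> chi_order.
rewrite (partition_big (fun t : 'F_p => t ^+ n) xpredT) //=.
apply: eq_bigr => x _.
rewrite -(card_nth_roots_mulchar x chi_order) mulr_natl -sumr_const.
by apply: eq_big => [t | t /eqP-> //]; rewrite inE.
Qed.

(** The values at nonzero arguments are roots of unity, of modulus 1; at 0 the
    equality uses 0^-1 = 0. *)
Lemma conj_mulchar (R : realType) (p : nat) (chi : mulchar R p) (n : nat) (x : 'F_p) :
  mulchar_has_order chi n -> (chi x)^* = (chi x)^-1.
Proof.
case=> n0 chin _; have [->|x0] := eqVneq x 0.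
  by rewrite mulchar0 rmorph0 invr0.
rewrite invC_norm; have -> : `|chi x| = 1.
  by apply/eqP; rewrite -(pexpr_eq1 n0) // -normrX chin // normr1.
by rewrite expr1n invr1 mul1r.
Qed.

(** * The quadratic character *)

Lemma Fp_natr_neq0 (p n : nat) : prime p -> (0 < n < p)%N -> (n%:R : 'F_p) != 0.
Proof.
by move=> p_pr /andP[n0 np]; rewrite -(dvdn_pcharf (pchar_Fp p_pr)) gtnNdvd.
Qed.

Lemma card_square_roots (R : realType) (p : nat) (x : 'F_p) : prime p -> (2 < p)%N ->
  #|[set y : 'F_p | y ^+ 2 == x]|%:R = 1 + quadratic_char R p x.
Proof.
move=> p_pr p_gt2; rewrite /= /legendre.
have n2 := @Fp_natr_neq0 p 2 p_pr p_gt2.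
have [->|x0] := eqVneq x 0.
  have -> : [set t : 'F_p | t ^+ 2 == 0] = [set 0].
    by apply/setP=> t; rewrite !inE expf_eq0.
  by rewrite cards1 addr0.
have [/existsP[y /eqP yE]|/existsPn xN] := boolP [exists y : 'F_p, y ^+ 2 == x].
  have -> : [set t : 'F_p | t ^+ 2 == x] = [set y; - y].
    by apply/setP=> t; rewrite !inE -yE eqf_sqr.
  rewrite cards2 (_ : y != - y) // -subr_eq0 opprK -mulr2n -mulr_natr mulf_neq0 //.
  by apply: contraNneq x0 => y0; rewrite -yE y0 expr0n.
suff -> : [set t : 'F_p | t ^+ 2 == x] = set0 by rewrite cards0 subrr.
by apply/setP=> t; rewrite !inE (negPf (xN t)).
Qed.

Lemma card_Fp_natr (R : realType) (p : nat) : prime p ->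
  \sum_(x : 'F_p) (1 : R[i]) = p%:R.
Proof. by move=> p_pr; rewrite sumr_const card_Fp. Qed.

(** Counting F_p by the squares of its elements gives
    p = sum_x (1 + phi x) = p + sum_x phi x. *)
Lemma sum_quadratic_char (R : realType) (p : nat) : prime p -> (2 < p)%N ->
  \sum_x quadratic_char R p x = 0.
Proof.
move=> p_pr p_gt2; apply: (addrI p%:R); rewrite addr0 -{1}(card_Fp_natr R p_pr).
rewrite -big_split -[RHS](card_Fp_natr R p_pr).
rewrite [RHS](partition_big (fun y : 'F_p => y ^+ 2) xpredT) //=.
apply: eq_bigr => x _; rewrite -(card_square_roots R x p_pr p_gt2) sumr_const.
by congr (_%:R); apply: eq_card => y; rewrite inE.
Qed.

Lemma quadratic_char_sqr (R : realType) (p : nat) (x : 'F_p) :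
  x != 0 -> quadratic_char R p (x ^+ 2) = 1.
Proof.
move=> x0; rewrite /= /legendre expf_eq0 (negPf x0) andbF ifT //.
by apply/existsP; exists x.
Qed.

Lemma conj_quadratic_char (R : realType) (p : nat) (x : 'F_p) :
  (quadratic_char R p x)^* = quadratic_char R p x.
Proof.
rewrite /= /legendre; case: ifP => _; [|case: ifP => _];
  by rewrite ?rmorph0 ?rmorphN1 ?rmorph1.
Qed.


(** * Gauss and Jacobi sums *)

Lemma expi0 (R : realType) : expi (0 : R) = 1.
Proof. by rewrite /expi cos0 sin0. Qed.

Lemma expiD (R : realType) (s t : R) : expi (s + t) = expi s * expi t.
Proof. by rewrite /expi cosD sinD; congr Complex; rewrite addrC. Qed.

Lemma expi_natr (R : realType) (t : R) (n : nat) : expi (n%:R * t) = expi t ^+ n.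
Proof.
elim: n => [|n IHn]; first by rewrite mul0r expi0 expr0.
by rewrite -natr1 mulrDl mul1r expiD IHn exprSr.
Qed.

Lemma expi_2pi (R : realType) : expi (2 * pi : R) = 1.
Proof. by rewrite mulr_natl /expi -[_ *+ 2]add0r cosD2pi sinD2pi cos0 sin0. Qed.

Definition exp2pi_div (R : realType) (p : nat) : R[i] := expi (2 * pi / p%:R).

Lemma exp2pi_divX (R : realType) (p : nat) : (0 < p)%N -> exp2pi_div R p ^+ p = 1.
Proof.
move=> p0; rewrite -expi_natr mulrCA divff ?mulr1 ?expi_2pi //.
by rewrite pnatr_eq0 -lt0n.
Qed.

Lemma exp2pi_div_neq1 (R : realType) (p : nat) : (2 < p)%N -> exp2pi_div R p != 1.
Proof.
move=> p2; have p0 : (0 : R) < p%:R by rewrite ltr0n (ltn_trans _ p2).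
(* Its imaginary part is positive, since 0 < 2 pi / p < pi. *)
rewrite eq_complex negb_and; apply/orP; right; rewrite /= gt_eqF // sin_gt0_pi //.
rewrite divr_gt0 ?mulr_gt0 ?pi_gt0 //= ltr_pdivrMr // mulrC ltr_pM2l ?pi_gt0 //.
by rewrite ltr_nat.
Qed.

(** The p-periodicity of the powers of e^(2 pi i / p) makes this an additive
    character of F_p ([addcharD]). *)
Definition addchar (R : realType) (p : nat) (x : 'F_p) : R[i] := exp2pi_div R p ^+ x.

Lemma addcharD (R : realType) (p : nat) (x y : 'F_p) :
  prime p -> addchar R (x + y) = addchar R x * addchar R y.
Proof.
move=> p_pr; rewrite /addchar -exprD /=; set n := (x + y)%N.
have -> : (Zp_trunc (pdiv p)).+2 = p by apply: Fp_cast.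
by rewrite [in RHS](divn_eq n p) exprD mulnC exprM exp2pi_divX ?expr1n ?mul1r ?prime_gt0.
Qed.

Lemma addchar1 (R : realType) (p : nat) : prime p -> addchar R (1 : 'F_p) = exp2pi_div R p.
Proof. by move=> p_pr; rewrite /addchar /= modn_small. Qed.

Lemma gauss_sumE (R : realType) (p : nat) (chi : mulchar R p) :
  gauss_sum chi = \sum_x chi x * addchar R x.
Proof.
apply: eq_bigr => x _; rewrite /addchar /exp2pi_div -expi_natr.
by rewrite [in RHS]mulrA [in RHS](mulrC _ (2 * pi)).
Qed.

Lemma sum_addchar_mul (R : realType) (p : nat) (y : 'F_p) : prime p -> (2 < p)%N ->
  \sum_b addchar R (b * y) = if y == 0 then p%:R else 0.
Proof.
move=> p_pr p_gt2; have [->|y0] := eqVneq y 0.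
  rewrite -(card_Fp_natr R p_pr); apply: eq_bigr => b _.
  by rewrite mulr0 /addchar expr0.
rewrite -(reindex_inj (mulIf y0) (P := xpredT) (F := @addchar R p)) /=.
set S := \sum_b _; have: addchar R (1 : 'F_p) * S = S.
  rewrite mulr_sumr [RHS](reindex_inj (addrI 1)) /=.
  by apply: eq_bigr => b _; rewrite addcharD.
move/eqP; rewrite -subr_eq0 -{2}[S]mul1r -mulrBl mulf_eq0 subr_eq0 addchar1 //.
by rewrite (negPf (exp2pi_div_neq1 R p_gt2)) => /eqP.
Qed.

(** If G(chi) were 0, then the substitution x -> b x would show that all the
    Fourier coefficients sum_x chi(x) e(b x) vanish, including the one at b = 0
    because chi is nontrivial.  Fourier inversion at 1 would then give
    p chi(1) = 0. *)
Lemma gauss_sum_neq0 (R : realType) (p : nat) (chi : mulchar R p) (a : 'F_p) :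
  prime p -> (2 < p)%N -> a != 0 -> chi a != 1 -> gauss_sum chi != 0.
Proof.
move=> p_pr p_gt2 a0 chia; apply/eqP=> G0.
have fourier0 b : \sum_x chi x * addchar R (b * x) = 0.
  have [->|b0] := eqVneq b 0.
    rewrite -[RHS](sum_mulchar_eq0 a0 chia); apply: eq_bigr => x _.
    by rewrite mul0r /addchar expr0 mulr1.
  apply: (mulfI (mulchar_neq0 chi b0)); rewrite mulr0 mulr_sumr -[RHS]G0 gauss_sumE.
  rewrite [RHS](reindex_inj (mulfI b0)) /=; apply: eq_bigr => x _.
  by rewrite mulcharM mulrA.
have : \sum_b addchar R (- b) * (\sum_x chi x * addchar R (b * x)) = p%:R.
  transitivity (\sum_x chi x * \sum_b addchar R (b * (x - 1))).
    under eq_bigr do rewrite mulr_sumr.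
    rewrite exchange_big; apply: eq_bigr => x _; rewrite mulr_sumr.
    apply: eq_bigr => b _; rewrite mulrCA -addcharD //.
    by congr (_ * addchar R _); ring.
  rewrite (bigD1 1) //= sum_addchar_mul // subrr eqxx mulchar1 mul1r big1 ?addr0 // => x x1.
  by rewrite sum_addchar_mul // subr_eq0 (negPf x1) mulr0.
rewrite big1 => [|b _]; last by rewrite fourier0 mulr0.
by move/esym/eqP; rewrite pnatr_eq0 -leqn0 leqNgt prime_gt0.
Qed.

(** Write the product as a sum of chi(x) psi(s - x) e(s) over x and s = x + y.
    For s nonzero, x = s u extracts chi(s) psi(s) J(chi, psi); for s = 0 the
    inner sum is psi(-1) times the sum of the nontrivial character chi psi. *)
Lemma gauss_sum_mul (R : realType) (p : nat) (chi psi : mulchar R p) (a : 'F_p) :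
  prime p -> a != 0 -> mulchar_mul chi psi a != 1 ->
  gauss_sum chi * gauss_sum psi = jacobi_sum chi psi * gauss_sum (mulchar_mul chi psi).
Proof.
move=> p_pr a0 chipsia; rewrite !gauss_sumE mulr_suml mulr_sumr.
transitivity (\sum_s (\sum_x chi x * psi (s - x)) * addchar R s).
  under [RHS]eq_bigr do rewrite mulr_suml.
  rewrite [RHS]exchange_big /=; apply: eq_bigr => x _.
  rewrite mulr_sumr [RHS](reindex_inj (addrI x)) /=; apply: eq_bigr => y _.
  by rewrite addcharD // [x + y - x]addrAC subrr add0r mulrACA.
apply: eq_bigr => s _; rewrite mulrA; congr (_ * _).
have [->|s0] := eqVneq s 0.
  rewrite mulchar0 mulr0 -[RHS](mulr0 (psi (-1))) -[in RHS](sum_mulchar_eq0 a0 chipsia) mulr_sumr.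
  by apply: eq_bigr => x _; rewrite sub0r -(mulN1r x) mulcharM mulrCA.
rewrite (reindex_inj (mulfI s0)) /jacobi_sum mulr_suml; apply: eq_bigr => x _.
by rewrite -{2}[s]mulr1 -mulrBr !mulcharM /= mulrACA mulrC.
Qed.

(** * The cubic character *)

(** On squares phi is 1 and chi3 is chi3(a)^2, which differs from 1 as soon as
    chi3(a) does, because chi3(a)^3 = 1. *)
Lemma cubic_mulchar_witness (R : realType) (p : nat) (chi3 : mulchar R p) :
  mulchar_has_order chi3 3 ->
  exists2 a : 'F_p, a != 0 & mulchar_mul chi3 (quadratic_char R p) a != 1.
Proof.
move=> [_ chi3_3 chi3_min]; have [//|a a0] := chi3_min 1; rewrite expr1 => chia.
exists (a ^+ 2); first by rewrite expf_neq0.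
have -> : mulchar_mul chi3 (quadratic_char R p) (a ^+ 2) = chi3 a ^+ 2.
  by rewrite -mulcharX -[RHS]mulr1 -(quadratic_char_sqr R a0).
apply: contraNneq chia => chia2.
by rewrite -(chi3_3 a a0) exprS chia2 mulr1.
Qed.

(** If w is a primitive cube root of unity, then w^2 + w + 1 = 0, and
    (2 w + 1)^2 = 4 (w^2 + w + 1) - 3 = -3. *)
Lemma quadratic_char_N3 (R : realType) (p : nat) (chi3 : mulchar R p) :
  prime p -> (3 < p)%N -> mulchar_has_order chi3 3 -> quadratic_char R p (- 3) = 1.
Proof.
move=> p_pr p_gt3 /mulchar_order_nth_root[w w_prim].
have w1 : w - 1 != 0 by rewrite subr_eq0 -[w]expr1 -(prim_order_dvd w_prim).
have wE : w ^+ 2 + w + 1 = 0.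
  apply: (mulfI w1); rewrite (_ : _ * (_ + 1) = w ^+ 3 - 1); last by ring.
  by rewrite (prim_expr_order w_prim) subrr mulr0.
have sqrE : - 3 = (2 * w + 1) ^+ 2 :> 'F_p.
  have -> : (2 * w + 1) ^+ 2 = 4 * (w ^+ 2 + w + 1) - 3 by ring.
  by rewrite wE mulr0 sub0r.
rewrite sqrE quadratic_char_sqr // -sqrf_eq0 -sqrE oppr_eq0.
exact: (@Fp_natr_neq0 p 3).
Qed.

(** Group the values of t by their cube x, which has 1 + chi3(x) + chi3(x)^2
    cube roots; chi3(x)^2 is the conjugate of chi3(x), and the constant term
    contributes sum_x phi(1 - x) = 0. *)
Lemma sum_cubic_jacobi (R : realType) (p : nat) (chi3 : mulchar R p) :
  prime p -> (2 < p)%N -> mulchar_has_order chi3 3 ->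
  let phi := quadratic_char R p in
  \sum_t phi (1 - t ^+ 3) = 2 * 'Re (jacobi_sum chi3 phi).
Proof.
move=> p_pr p_gt2 chi3_order phi.
have [_ chi3_3 _] := chi3_order.
rewrite (sum_comp_nth_power (fun x => phi (1 - x)) chi3_order) ReE mulrC divfK ?pnatr_eq0 //.
rewrite /jacobi_sum rmorph_sum -big_split /=.
rewrite -[RHS]add0r -[X in _ = X + _](sum_quadratic_char R p_pr p_gt2).
rewrite [X in _ = X + _](reindex_inj (inv_inj (subKr 1))) -big_split /=; apply: eq_bigr => x _.
rewrite rmorphM /= conj_quadratic_char (conj_mulchar x chi3_order) !big_ord_recl big_ord0 /=.
rewrite expr0 expr1 addr0 !mulrDl mul1r; congr (_ + (_ + _ * _)).
have [->|x0] := eqVneq x 0; first by rewrite mulchar0 expr0n invr0.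
apply: (mulfI (mulchar_neq0 chi3 x0)); rewrite -exprS divff ?mulchar_neq0 //.
exact: chi3_3.
Qed.

(** * Counting points on the curve *)

Lemma card_pair_set (T U : finType) (P : T -> U -> bool) :
  #|[set z : T * U | P z.1 z.2]| = (\sum_x #|[set y | P x y]|)%N.
Proof.
rewrite -sum1_card; under [RHS]eq_bigr do rewrite -sum1_card.
by rewrite pair_big_dep; apply: eq_bigl => z; rewrite !inE.
Qed.

Lemma card_on_curve_sqr (R : realType) (p : nat) (W : weierstrass 'F_p)
    (f : 'F_p -> 'F_p) :
  prime p -> (2 < p)%N ->
  (forall x y, on_affine_curve W x y = (y ^+ 2 == f x)) ->
  #|[set P | on_curve W P]|%:R = 1 + p%:R + \sum_x quadratic_char R p (f x) :> R[i].
Proof.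
move=> p_pr p_gt2 WE.
have -> : [set P | on_curve W P] =
    None |: Some @: [set z : 'F_p * 'F_p | z.2 ^+ 2 == f z.1].
  apply/setP=> -[[x y]|]; last by rewrite !inE.
  by rewrite !inE mem_imset ?inE /= ?WE // => ? ? [].
rewrite cardsU1 card_imset; last by move=> ? ? [].
rewrite (_ : None \notin _); last by apply/imsetP=> -[].
rewrite natrD -addrA; congr (_ + _).
rewrite (card_pair_set (fun x y => y ^+ 2 == f x)) natr_sum -(card_Fp_natr R p_pr).
rewrite -big_split; apply: eq_bigr => x _.
exact: card_square_roots.
Qed.

Lemma trace_of_frobenius_E_third (R : realType) (p : nat) : prime p -> (3 < p)%N ->
  (trace_of_frobenius p E_third)%:~R =
    - \sum_x quadratic_char R p ((x - 1) * (x ^+ 2 + 3^-1)) :> R[i].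
Proof.
move=> p_pr p_gt3; have p_gt2 : (2 < p)%N by apply: ltnW.
have n3 : (3 : 'F_p) != 0 := @Fp_natr_neq0 p 3 p_pr p_gt3.
have ratrE (a : rat) (n d : int) : numq a = n -> denq a = d ->
    ratr a = n%:~R / d%:~R :> 'F_p by rewrite /ratr => -> ->.
have curveE (x y : 'F_p) : on_affine_curve (reduction p E_third) x y =
    (y ^+ 2 == (x - 1) * (x ^+ 2 + 3^-1)).
  rewrite /on_affine_curve /= (@ratrE 0 0 1) // (@ratrE (-1) (-1) 1) //.
  rewrite (@ratrE (1 / 3) 1 3) // (@ratrE (- (1 / 3)) (-1) 3) //.
  congr (_ == _); first by rewrite mulr0z !mul0r !addr0.
  by field; rewrite n3 oner_neq0.
rewrite /trace_of_frobenius mulrzBr mulrzDr -!pmulrn.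
rewrite (card_on_curve_sqr R p_pr p_gt2 curveE); ring.
Qed.

(** With c = -2/3, the substitution x = 1 + c (1 - t) gives
    (x - 1) (x^2 + 1/3) = c^3 (1 - t^3), and c^3 = (2/9)^2 (-3) 2. *)
Lemma sum_E_third_cubic (R : realType) (p : nat) : prime p -> (3 < p)%N ->
  let phi := quadratic_char R p in
  phi (- 3) = 1 ->
  \sum_x phi ((x - 1) * (x ^+ 2 + 3^-1)) = phi 2 * \sum_t phi (1 - t ^+ 3).
Proof.
move=> p_pr p_gt3 phi phiN3.
have n2 : (2 : 'F_p) != 0 := @Fp_natr_neq0 p 2 p_pr (ltnW p_gt3).
have n3 : (3 : 'F_p) != 0 := @Fp_natr_neq0 p 3 p_pr p_gt3.
have sub_inj : injective (fun t : 'F_p => 1 - (2 / 3) * (1 - t)).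
  apply: (can_inj (g := fun x => 1 - (1 - x) * (3 / 2))) => t.
  by field; rewrite n2 n3.
rewrite (reindex_inj sub_inj) mulr_sumr; apply: eq_bigr => t _.
rewrite (_ : _ * _ = (2 / 9) ^+ 2 * (- 3 * (2 * (1 - t ^+ 3)))).
  rewrite mulcharM quadratic_char_sqr ?mul1r; last first.
    by rewrite mulf_neq0 // invr_eq0 (natrX _ 3 2) expf_neq0.
  by rewrite mulcharM [quadratic_char R p (- 3)]phiN3 mul1r mulcharM.
by field; rewrite n3 (natrX _ 3 2) expf_neq0.
Qed.

Lemma quadratic_char_real (R : realType) (p : nat) (x : 'F_p) :
  quadratic_char R p x \is Num.real.
Proof. by apply/CrealP; exact: conj_quadratic_char. Qed.

(** * The trace of Frobenius as a Jacobi sum *)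

Theorem theorem2p3 (R : realType) (p : nat) (p_prime : prime p) (p_gt3 : (3 < p)%N)
    (chi3 : mulchar R p) (chi3_order : mulchar_has_order chi3 3) :
  let phi : mulchar R p := quadratic_char R p in
  let a_p : R[i] := (trace_of_frobenius p E_third)%:~R in
  - (phi (-2) / p%:R) * a_p = 2 * 'Re (ff_binomial chi3 phi) /\
  - phi 2 * a_p =
    2 * 'Re (gauss_sum chi3 * gauss_sum phi / gauss_sum (mulchar_mul chi3 phi)).
Proof.
move=> phi a_p; have p_gt2 := ltnW p_gt3.
have n2 : (2 : 'F_p) != 0 := @Fp_natr_neq0 p 2 p_prime p_gt2.
have a_pE : a_p = - (phi 2 * (2 * 'Re (jacobi_sum chi3 phi))).
  rewrite -(sum_cubic_jacobi p_prime p_gt2 chi3_order) -sum_E_third_cubic //.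
    exact: trace_of_frobenius_E_third.
  exact: quadratic_char_N3 chi3_order.
have phi22 : phi 2 * phi 2 = 1 by rewrite -mulcharM -expr2 quadratic_char_sqr.
split.
  have binomE : ff_binomial chi3 phi = phi (-1) / p%:R * jacobi_sum chi3 phi.
    congr (_ * _); apply: eq_bigr => x _; congr (_ * _).
    exact: conj_quadratic_char.
  rewrite binomE ReMl; last by rewrite rpredM ?rpredV ?realn ?quadratic_char_real.
  rewrite a_pE -mulN1r mulcharM.
  transitivity (phi 2 * phi 2 * (phi (-1) / p%:R * (2 * 'Re (jacobi_sum chi3 phi)))).
    by ring.
  by rewrite phi22 mul1r mulrCA.
have [a a0 chia] := cubic_mulchar_witness chi3_order.
rewrite (gauss_sum_mul p_prime a0 chia) mulfK ?(gauss_sum_neq0 p_prime p_gt2 a0 chia) //.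
by rewrite a_pE mulrNN mulrA phi22 mul1r.
Qed.
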